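(* Let $m>0$, $n>0$ be integers and let $\mathcal{T}=\mathrm{Tri}(A,M,B)$ be a triangular ring satisfying the following conditions: (i) if $a\in A$ and $aA=0$, then $a=0$; (ii) if $b\in B$ and $bB=0$, then $b=0$; (iii) if $a\in A$ and $Aa=0$, then $a=0$; (iv) $\mathcal{T}$ is $mn(m+n)$-torsion free. Let $D:\mathcal{T}\to\mathcal{T}$ be a map (not assumed additive) satisfying $$(m+n)D(ab)=2mD(a)b+2naD(b)$$ for all $a,b\in\mathcal{T}$. Then $D$ is additive, i.e. $D(a+b)=D(a)+D(b)$ for all $a,b\in\mathcal{T}$. Moreover, $D$ is an $(m,n)$-derivation.
   Context: Rings are associative and not assumed to have an identity. Triangular ring: let $A$ and $B$ be rings and $M$ an $(A,B)$-bimodule such that (a) $M$ is faithful as a left $A$-module and as a right $B$-module; (b) if $x\in M$ and $AxB=0$ (i.e. $axb=0$ for all $a\in A$, $b\in B$), then $x=0$. Then $\mathcal{T}=\mathrm{Tri}(A,M,B)=\left\{\begin{pmatrix} a & x\\ 0& b\end{pmatrix} : a\in A,\ x\in M,\ b\in B\right\}$, with the usual matrix addition and multiplication, is called a triangular ring. For an integer $k\ge 2$, a ring $R$ is $k$-torsion free if $ka=0$ with $a\in R$ implies $a=0$. For integers $m,n\ge 0$, an $(m,n)$-derivation of a ring $R$ is an additive map $D:R\to R$ satisfying $(m+n)D(ab)=2mD(a)b+2naD(b)$ for all $a,b\in R$. *)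

(* Defs.v *)
From HB Require Import structures.
From mathcomp Require Import all_boot all_algebra.

Set Implicit Arguments.
Unset Strict Implicit.
Unset Printing Implicit Defensive.

Import GRing.Theory.

(* The product of a ring is its semigroup product [(x * y)%g]: the product of
   ssralg in ring_scope comes with an identity element. *)
Local Open Scope ring_scope.

HB.mixin Record Zmodule_Semigroup_isRng R of GRing.Zmodule R & Semigroup R := {
  rngDl : left_distributive ( *%g : R -> R -> R) +%R;
  rngDr : right_distributive ( *%g : R -> R -> R) +%R
}.

(* Associative rings, not assumed to have an identity. *)
#[short(type="rngType")]
HB.structure Definition Rng :=
  { R of GRing.Zmodule R & Semigroup R & Zmodule_Semigroup_isRng R }.

HB.mixin Record Zmodule_isBimodule (A B : rngType) M of GRing.Zmodule M := {
  lact : A -> M -> M;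
  ract : M -> B -> M;
  lactDl : forall a1 a2 x, lact (a1 + a2) x = lact a1 x + lact a2 x;
  lactDr : forall a x y, lact a (x + y) = lact a x + lact a y;
  lactA : forall a1 a2 x, lact (a1 * a2)%g x = lact a1 (lact a2 x);
  ractDl : forall x y b, ract (x + y) b = ract x b + ract y b;
  ractDr : forall x b1 b2, ract x (b1 + b2) = ract x b1 + ract x b2;
  ractA : forall x b1 b2, ract x (b1 * b2)%g = ract (ract x b1) b2;
  lractA : forall a x b, ract (lact a x) b = lact a (ract x b)
}.

#[short(type="bimodType")]
HB.structure Definition Bimodule (A B : rngType) :=
  { M of GRing.Zmodule M & Zmodule_isBimodule A B M }.

(* The conditions on the bimodule M in the definition of a triangular ring. *)
Record triangular (A B : rngType) (M : bimodType A B) : Prop := Triangular {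
  tri_faithful_left : forall a : A, (forall x : M, lact a x = 0) -> a = 0;
  tri_faithful_right : forall b : B, (forall x : M, ract x b = 0) -> b = 0;
  tri_nondegenerate :
    forall x : M, (forall (a : A) (b : B), ract (lact a x) b = 0) -> x = 0
}.

(* [Tri a x b] is the matrix with rows (a, x) and (0, b). *)
Record tri (A B : rngType) (M : bimodType A B) : Type :=
  Tri { tri_ul : A; tri_ur : M; tri_lr : B }.

Section TriRng.
Variables (A B : rngType) (M : bimodType A B).
Implicit Types s t u : tri M.

Definition prod_of_tri t : A * M * B := (tri_ul t, tri_ur t, tri_lr t).
Definition tri_of_prod (p : A * M * B) : tri M := Tri p.1.1 p.1.2 p.2.

Lemma prod_of_triK : cancel prod_of_tri tri_of_prod.
Proof. by case. Qed.

HB.instance Definition _ := Choice.copy (tri M) (can_type prod_of_triK).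

Definition tri_zero : tri M := Tri 0 0 0.
Definition tri_opp t : tri M := Tri (- tri_ul t) (- tri_ur t) (- tri_lr t).
Definition tri_add s t : tri M :=
  Tri (tri_ul s + tri_ul t) (tri_ur s + tri_ur t) (tri_lr s + tri_lr t).
Definition tri_mul s t : tri M :=
  Tri (tri_ul s * tri_ul t)%g
      (lact (tri_ul s) (tri_ur t) + ract (tri_ur s) (tri_lr t))
      (tri_lr s * tri_lr t)%g.

Fact tri_addA : associative tri_add.
Proof. by move=> s t u; rewrite /tri_add /= !addrA. Qed.

Fact tri_addC : commutative tri_add.
Proof. by move=> s t; congr Tri; rewrite addrC. Qed.

Fact tri_add0 : left_id tri_zero tri_add.
Proof. by case=> a x b; rewrite /tri_add /= !add0r. Qed.

Fact tri_addN : left_inverse tri_zero tri_opp tri_add.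
Proof. by case=> a x b; rewrite /tri_add /= !addNr. Qed.

HB.instance Definition _ :=
  GRing.isZmodule.Build (tri M) tri_addA tri_addC tri_add0 tri_addN.

Fact tri_mulA : associative tri_mul.
Proof.
by move=> s t u; rewrite /tri_mul /= !mulgA lactDr ractDl lactA ractA lractA addrA.
Qed.

HB.instance Definition _ := isSemigroup.Build (tri M) tri_mulA.

Fact tri_mulDl : left_distributive tri_mul +%R.
Proof.
by move=> s t u; congr Tri; rewrite /= ?rngDl // lactDl ractDl addrACA.
Qed.

Fact tri_mulDr : right_distributive tri_mul +%R.
Proof.
by move=> s t u; congr Tri; rewrite /= ?rngDr // lactDr ractDr addrACA.
Qed.

HB.instance Definition _ :=
  Zmodule_Semigroup_isRng.Build (tri M) tri_mulDl tri_mulDr.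

End TriRng.

Definition torsion_free (k : nat) (R : rngType) : Prop :=
  forall a : R, a *+ k = 0 -> a = 0.

Definition mn_identity (m n : nat) (R : rngType) (D : R -> R) : Prop :=
  forall a b : R,
    D (a * b)%g *+ (m + n) = (D a * b)%g *+ (2 * m) + (a * D b)%g *+ (2 * n).

Definition mn_derivation (m n : nat) (R : rngType) (D : R -> R) : Prop :=
  {morph D : a b / a + b} /\ mn_identity m n D.

(* Main.v *)
(* The defect [f s t = D (s + t) - D s - D t] satisfies
   [(m + n) f (s u) (t u) = 2m (f s t) u] and
   [(m + n) f (u s) (u t) = 2n u (f s t)]; hence a product of [f s t] with [u]
   vanishes as soon as the defect of the two products does.  Multiplying by
   matrices with one nonzero entry kills [f s t] when [s] and [t] have disjoint
   supports, so [D] splits as a sum over the three entries.  Expanding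
   [D ((a + x) (y + b))], where [(a + x) (y + b) = a y + x b], then shows that
   [f (a y) (x b) = 0]; nondegeneracy of [M] gives additivity on [M], and
   faithfulness of [M] carries it over to [A] and [B]. *)
Require Import Defs.
From mathcomp Require Import all_boot all_algebra.

Set Implicit Arguments.
Unset Strict Implicit.
Unset Printing Implicit Defensive.

Import GRing.Theory.

Local Open Scope ring_scope.

(** In the defect identities [y] and [z] are the terms carrying [D u], with [u] the common
    factor. *)
Lemma addr_sub2 (V : zmodType) (x x1 x2 y z : V) :
  x + (y + z) - (x1 + y) - (x2 + z) = x - x1 - x2.
Proof.
apply/eqP; rewrite !subr_eq [_ + (x2 + z)]addrA subrK addrACA subrK.
by rewrite [z + y]addrC.
Qed.

Section RngTheory.
Variable R : rngType.
Implicit Types a b c : R.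

Lemma rng_mul0r a : (0 * a)%g = 0 :> R.
Proof. by apply: (addrI (0 * a)%g); rewrite -rngDl !addr0. Qed.

Lemma rng_mulr0 a : (a * 0)%g = 0 :> R.
Proof. by apply: (addrI (a * 0)%g); rewrite -rngDr !addr0. Qed.

Lemma rng_mulBl a b c : ((a - b) * c)%g = (a * c)%g - (b * c)%g :> R.
Proof. by apply/eqP; rewrite eq_sym subr_eq -rngDl subrK. Qed.

Lemma rng_mulBr a b c : (a * (b - c))%g = (a * b)%g - (a * c)%g :> R.
Proof. by apply/eqP; rewrite eq_sym subr_eq -rngDr subrK. Qed.

Lemma rng_mulrnAl a b k : ((a *+ k) * b)%g = (a * b)%g *+ k :> R.
Proof.
by elim: k => [|k IHk]; rewrite ?mulr0n ?rng_mul0r // !mulrS rngDl IHk.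
Qed.

(** If [k] kills [a], so does [N ^ e], and the factors [N] are stripped one at a time. Powers are
    needed because [2 * m] need not divide [m * n * (m + n)]. *)
Lemma torsion_free_dvd_expn (k N e : nat) :
  (k %| N ^ e)%N -> torsion_free N R -> torsion_free k R.
Proof.
move=> /dvdnP[q def_q] torN a ak0.
have: a *+ (N ^ e)%N = 0 by rewrite def_q mulnC mulrnA ak0 mul0rn.
elim: e {def_q} => // e IHe; rewrite expnSr mulrnA => /torN; exact: IHe.
Qed.

End RngTheory.

Section BimoduleTheory.
Variables (A B : rngType) (M : bimodType A B).

Lemma lact0 (x : M) : lact (0 : A) x = 0.
Proof. by apply: (addrI (lact 0 x)); rewrite -lactDl !addr0. Qed.

Lemma lactr0 (a : A) : lact a (0 : M) = 0.
Proof. by apply: (addrI (lact a 0)); rewrite -lactDr !addr0. Qed.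

Lemma ract0 (b : B) : ract (0 : M) b = 0.
Proof. by apply: (addrI (ract 0 b)); rewrite -ractDl !addr0. Qed.

Lemma ractr0 (x : M) : ract x (0 : B) = 0.
Proof. by apply: (addrI (ract x 0)); rewrite -ractDr !addr0. Qed.

End BimoduleTheory.

(** * Calculus of the defect in an arbitrary ring *)

Definition defect (R : rngType) (D : R -> R) (s t : R) : R :=
  D (s + t) - D s - D t.

Section Defect.
Variables (R : rngType) (m n : nat) (D : R -> R).
Hypothesis tor_m : torsion_free (2 * m) R.
Hypothesis tor_n : torsion_free (2 * n) R.
Hypothesis tor_mn : torsion_free (m + n) R.
Hypothesis DM : mn_identity m n D.
Implicit Types s t u : R.

Local Notation f := (defect D).

Lemma mn_identity0 : D 0 = 0.
Proof.
by apply: tor_mn; rewrite -(rng_mul0r 0) DM rng_mulr0 !rng_mul0r !mul0rn addr0.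
Qed.

Lemma defect0r s : f s 0 = 0.
Proof. by rewrite /defect mn_identity0 addr0 !subrr. Qed.

Lemma defect0l s : f 0 s = 0.
Proof. by rewrite /defect mn_identity0 add0r subr0 subrr. Qed.

Lemma defect_eq0 s t : f s t = 0 <-> D (s + t) = D s + D t.
Proof.
by rewrite /defect -addrA -opprD; split=> [/subr0_eq //|->]; rewrite subrr.
Qed.

Lemma defectMr s t u : f (s * u)%g (t * u)%g *+ (m + n) =
  (f s t * u)%g *+ (2 * m).
Proof.
rewrite /defect -rngDl !mulrnBl !DM rngDl !rng_mulBl !mulrnBl mulrnDl.
exact: addr_sub2.
Qed.

Lemma defectMl s t u : f (u * s)%g (u * t)%g *+ (m + n) =
  (u * f s t)%g *+ (2 * n).
Proof.
rewrite /defect -rngDr !mulrnBl !DM rngDr !rng_mulBr !mulrnBl mulrnDl.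
(* Here the terms in [D u] come first in each sum; they are moved to second place for the
   cancellation. *)
rewrite [X in X - _ - _]addrC [X in _ - X - _]addrC [X in _ - X = _]addrC.
exact: addr_sub2.
Qed.

Lemma defect_mulr_eq0 s t u : f (s * u)%g (t * u)%g = 0 -> (f s t * u)%g = 0.
Proof. by move=> f0; apply: tor_m; rewrite -defectMr f0 mul0rn. Qed.

Lemma defect_mull_eq0 s t u : f (u * s)%g (u * t)%g = 0 -> (u * f s t)%g = 0.
Proof. by move=> f0; apply: tor_n; rewrite -defectMl f0 mul0rn. Qed.

(** The inner defect [f (u * s) (u * t)] is only known to vanish after multiplication by [v], so
    [defectMl] is multiplied by [v] on the right. *)
Lemma defect_mullr_eq0 s t u v :
  f (u * s * v)%g (u * t * v)%g = 0 -> (u * f s t * v)%g = 0.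
Proof.
move=> /defect_mulr_eq0 f0; apply: tor_n.
by rewrite -rng_mulrnAl -defectMl rng_mulrnAl f0 mul0rn.
Qed.

Lemma eq0_defectMr s t u : f s t = 0 -> f (s * u)%g (t * u)%g = 0.
Proof. by move=> f0; apply: tor_mn; rewrite defectMr f0 rng_mul0r mul0rn. Qed.

Lemma eq0_defectMl s t u : f s t = 0 -> f (u * s)%g (u * t)%g = 0.
Proof. by move=> f0; apply: tor_mn; rewrite defectMl f0 rng_mulr0 mul0rn. Qed.

(** A vanishing defect is inherited by left and right multiples. *)
Lemma mn_identity_expand s1 s2 t1 t2 : f s1 s2 = 0 -> f t1 t2 = 0 ->
  D ((s1 + s2) * (t1 + t2))%g =
  D (s1 * t1)%g + D (s1 * t2)%g + (D (s2 * t1)%g + D (s2 * t2)%g).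
Proof.
move=> fs ft; rewrite rngDl ((defect_eq0 _ _).1 (eq0_defectMr _ fs)) !rngDr.
by rewrite !((defect_eq0 _ _).1 (eq0_defectMl _ ft)).
Qed.

End Defect.

(** * Entrywise additivity on the triangular ring *)

Section TriAdditive.
Variables (A B : rngType) (M : bimodType A B) (m n : nat) (D : tri M -> tri M).
Hypothesis triM : triangular M.
Hypothesis annrA : forall a : A, (forall a' : A, (a * a')%g = 0) -> a = 0.
Hypothesis annrB : forall b : B, (forall b' : B, (b * b')%g = 0) -> b = 0.
Hypothesis annlA : forall a : A, (forall a' : A, (a' * a)%g = 0) -> a = 0.
Hypothesis tor_m : torsion_free (2 * m) (tri M).
Hypothesis tor_n : torsion_free (2 * n) (tri M).
Hypothesis tor_mn : torsion_free (m + n) (tri M).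
Hypothesis DM : mn_identity m n D.

Local Notation f := (defect D).
Local Notation eA a := (Tri a 0 0 : tri M).
Local Notation eM x := (Tri 0 x 0 : tri M).
Local Notation eB b := (Tri 0 0 b : tri M).

Lemma tri_mulE (a a' : A) (x x' : M) (b b' : B) :
  (Tri a x b * Tri a' x' b')%g =
  Tri (a * a')%g (lact a x' + ract x b') (b * b')%g.
Proof. by []. Qed.

Lemma tri_ulD (a a' : A) : eA a + eA a' = eA (a + a').
Proof. by congr Tri; rewrite addr0. Qed.

Lemma tri_urD (x x' : M) : eM x + eM x' = eM (x + x').
Proof. by congr Tri; rewrite addr0. Qed.

Lemma tri_lrD (b b' : B) : eB b + eB b' = eB (b + b').
Proof. by congr Tri; rewrite addr0. Qed.

Lemma tri_ul_restD (a : A) (x : M) (b : B) : eA a + Tri 0 x b = Tri a x b.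
Proof. by congr Tri; rewrite ?addr0 ?add0r. Qed.

Lemma tri_ur_lrD (x : M) (b : B) : eM x + eB b = Tri 0 x b.
Proof. by congr Tri; rewrite ?addr0 ?add0r. Qed.

Lemma tri0E : Tri 0 0 0 = 0 :> tri M. Proof. by []. Qed.

Let triE := (tri_mulE, @rng_mul0r, @rng_mulr0, lact0, lactr0, ract0, ractr0,
  addr0, add0r, tri0E).

Lemma tri_eq0r (F : tri M) :
  (forall a, (F * eA a)%g = 0) -> (forall b, (F * eB b)%g = 0) -> F = 0.
Proof.
case: F => a x b FA FB; rewrite -tri0E; congr Tri.
- by apply: annrA => a'; move: (FA a'); rewrite tri_mulE => -[].
- apply: (tri_nondegenerate triM) => a' b'; move: (FB b').
  by rewrite !triE => -[xb _]; rewrite lractA xb lactr0.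
- by apply: annrB => b'; move: (FB b'); rewrite tri_mulE => -[].
Qed.

(** The lower right entry [b] is detected inside [M]: the upper right entry of [eM x * F] is
    [ract x b]. *)
Lemma tri_eq0l (F : tri M) :
  (forall a, (eA a * F)%g = 0) -> (forall x, (eM x * F)%g = 0) -> F = 0.
Proof.
case: F => a x b FA FM; rewrite -tri0E; congr Tri.
- by apply: annlA => a'; move: (FA a'); rewrite tri_mulE => -[].
- apply: (tri_nondegenerate triM) => a' b'; move: (FA a').
  by rewrite !triE => -[_ ax]; rewrite ax ract0.
- apply: (tri_faithful_right triM) => x'; move: (FM x').
  by rewrite !triE => -[].
Qed.

Let D0 : D 0 = 0 := mn_identity0 tor_mn DM.
Let f0r := defect0r tor_mn DM.
Let f0l := defect0l tor_mn DM.
Let fr := defect_mulr_eq0 tor_m DM.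
Let fl := defect_mull_eq0 tor_n DM.

(** Right multiplication by [eA c] kills the second argument, by [eB c] the first. *)
Lemma defect_ul_rest a x b : f (eA a) (Tri 0 x b) = 0.
Proof. by apply: tri_eq0r => c; apply: fr; rewrite !triE ?f0r ?f0l. Qed.

(** Right multiplication by [eB c] can preserve both arguments, so the factors go on the left:
    [eA c] kills [eB b] and [eM c] kills [eM x]. *)
Lemma defect_ur_lr x b : f (eM x) (eB b) = 0.
Proof. by apply: tri_eq0l => c; apply: fl; rewrite !triE ?f0r ?f0l. Qed.

Lemma tri_split a x b : D (Tri a x b) = D (eA a) + D (eM x) + D (eB b).
Proof.
rewrite -addrA -((defect_eq0 _ _ _).1 (defect_ur_lr x b)) tri_ur_lrD.
by rewrite -((defect_eq0 _ _ _).1 (defect_ul_rest a x b)) tri_ul_restD.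
Qed.

Lemma defect_lact_ract a b x y : f (eM (lact a y)) (eM (ract x b)) = 0.
Proof.
(* Of the four products, [eA a * eB b] and [eM x * eM y] are zero. *)
have := mn_identity_expand tor_mn DM (defect_ul_rest a x 0) (defect_ur_lr y b).
rewrite tri_ul_restD tri_ur_lrD !triE D0 addr0 add0r => DS.
by apply/defect_eq0; rewrite tri_urD DS.
Qed.

Lemma additive_ur x y : D (eM (x + y)) = D (eM x) + D (eM y).
Proof.
suff /defect_eq0 : f (eM x) (eM y) = 0 by rewrite tri_urD.
have FA a : (f (eM x) (eM y) * eA a)%g = 0.
  by apply: fr; rewrite !triE f0r.
have FM z : (eM z * f (eM x) (eM y))%g = 0.
  by apply: fl; rewrite !triE f0r.
have FAB a b : (eA a * f (eM x) (eM y) * eB b)%g = 0.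
  apply: (defect_mullr_eq0 tor_m tor_n DM).
  (* Only the first argument is regrouped, as [a (x b)]; the second stays [(a y) b]. *)
  by rewrite !triE lractA defect_lact_ract.
case: (f _ _) FA FM FAB => a z b FA FM FAB; rewrite -tri0E; congr Tri.
- by apply: annrA => a'; move: (FA a'); rewrite tri_mulE => -[].
- apply: (tri_nondegenerate triM) => a' b'; move: (FAB a' b').
  by rewrite !triE => -[].
- apply: (tri_faithful_right triM) => x'; move: (FM x').
  by rewrite !triE => -[].
Qed.

(** Right multiplication by [eM x] moves both arguments into [M], where [D] is additive. *)
Lemma additive_ul a a' : D (eA (a + a')) = D (eA a) + D (eA a').
Proof.
suff /defect_eq0 : f (eA a) (eA a') = 0 by rewrite tri_ulD.
have FM x : (f (eA a) (eA a') * eM x)%g = 0.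
  by apply: fr; rewrite !triE; apply/defect_eq0; rewrite tri_urD additive_ur.
have FB b : (f (eA a) (eA a') * eB b)%g = 0 by apply: fr; rewrite !triE f0r.
case: (f _ _) FM FB => c x b FM FB; rewrite -tri0E; congr Tri.
- by apply: (tri_faithful_left triM) => y; move: (FM y); rewrite !triE => -[].
- apply: (tri_nondegenerate triM) => a1 b1; move: (FB b1).
  by rewrite !triE => -[xb _]; rewrite lractA xb lactr0.
- by apply: annrB => b1; move: (FB b1); rewrite tri_mulE => -[].
Qed.

Lemma additive_lr b b' : D (eB (b + b')) = D (eB b) + D (eB b').
Proof.
suff /defect_eq0 : f (eB b) (eB b') = 0 by rewrite tri_lrD.
(* [eA a] kills both arguments, and [eM x] moves them into [M]. *)
apply: tri_eq0l => [a|x]; apply: fl; rewrite !triE ?f0r //.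
by apply/defect_eq0; rewrite tri_urD additive_ur.
Qed.

Lemma tri_additive : {morph D : s t / s + t}.
Proof.
case=> a x b [a' x' b'].
have -> : Tri a x b + Tri a' x' b' =
          Tri (a + a') (x + x') (b + b') :> tri M by [].
rewrite (tri_split (a + a')) (tri_split a x) (tri_split a' x').
rewrite additive_ul additive_ur additive_lr.
by rewrite [RHS]addrACA [X in _ = X + _]addrACA.
Qed.

End TriAdditive.

Theorem theorem4p1 (A B : rngType) (M : bimodType A B) (m n : nat)
    (m_gt0 : (0 < m)%N) (n_gt0 : (0 < n)%N)
    (triM : triangular M)
    (annrA : forall a : A, (forall a' : A, (a * a')%g = 0) -> a = 0)
    (annrB : forall b : B, (forall b' : B, (b * b')%g = 0) -> b = 0)
    (annlA : forall a : A, (forall a' : A, (a' * a)%g = 0) -> a = 0)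
    (torT : torsion_free (m * n * (m + n))%N (tri M))
    (D : tri M -> tri M)
    (DM : forall a b : tri M,
       D (a * b)%g *+ (m + n) = (D a * b)%g *+ (2 * m) + (a * D b)%g *+ (2 * n)) :
  {morph D : a b / a + b} /\ mn_derivation m n D.
Proof.
(* If [m] and [n] are both odd, then [m + n] is even. *)
have dvd2 : (2 %| m * n * (m + n))%N.
  by rewrite dvdn2 !oddM oddD; case: (odd m); case: (odd n).
(* Both 2 and [k] divide [m * n * (m + n)], so [2 * k] divides its square. *)
have tor2 k : (k %| m * n * (m + n))%N -> torsion_free (2 * k) (tri M).
  move=> dvdk; apply: (@torsion_free_dvd_expn _ _ _ 2) torT.
  by rewrite expnS expn1 dvdn_mul.
have addD : {morph D : a b / a + b}.
  apply: (@tri_additive _ _ _ m n) => //.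
  - by apply: tor2; rewrite -mulnA dvdn_mulr.
  - by apply: tor2; rewrite mulnAC dvdn_mull.
  - by apply: (@torsion_free_dvd_expn _ _ _ 1) torT; rewrite expn1 dvdn_mull.
by split.
Qed.
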